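(* For every integer $n\ge 4$, the cycle $C_n$ on $n$ vertices satisfies $$\operatorname{th}_+(C_n)=\left\lceil \sqrt{2n}-\tfrac12\right\rceil .$$
   Context: All graphs are finite, simple and undirected. Positive semidefinite (PSD) color change rule: each vertex of $G$ is blue or white; let $B$ be the current set of blue vertices and let $W_1,\dots,W_k$ be the vertex sets of the connected components of $G-B$. A white vertex $w\in W_i$ is colored blue (is forced by the blue vertex $v$) when $w$ is the only white neighbor of $v$ in the induced subgraph $G[W_i\cup B]$. Starting with exactly the vertices of $S\subseteq V(G)$ blue, at each time step all possible forces are performed simultaneously. $S$ is a PSD zero forcing set if eventually all vertices become blue; in that case $\operatorname{pt}_+(G;S)$ is the number of time steps needed to color all vertices blue (so it is $0$ if $S=V(G)$), and otherwise $\operatorname{pt}_+(G;S)=\infty$. Define $\operatorname{th}_+(G;S)=|S|+\operatorname{pt}_+(G;S)$, and the PSD throttling number $\operatorname{th}_+(G)=\min\{\operatorname{th}_+(G;S): S \text{ is a PSD zero forcing set of } G\}$. *)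

(* Defs.v *)
From mathcomp Require Import all_boot all_order all_algebra.
From mathcomp Require Import boolp reals.

Set Implicit Arguments.
Unset Strict Implicit.
Unset Printing Implicit Defensive.

(* A finite simple undirected graph is a finType T of vertices with a symmetric
   and irreflexive adjacency relation e : rel T. *)

Section PSDZeroForcing.
Variables (T : finType) (e : rel T).
Implicit Types (B S : {set T}) (v w : T).

Definition white_adj B : rel T :=
  [rel x y | [&& x \notin B, y \notin B & e x y]].

(* Meaningful for w \notin B: the component of G - B containing w. For w \in B
   this is [set w], but psd_forces only uses it at white vertices. *)
Definition white_component B w : {set T} :=
  [set u | connect (white_adj B) w u].

Definition psd_forces B v w : bool :=
  [&& v \in B, w \notin B &
      [set u in white_component B w | e v u] == [set w]].

Definition psd_step B : {set T} :=
  B :|: [set w | [exists v, psd_forces B v w]].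

Definition psd_blue S (t : nat) : {set T} := iter t psd_step S.

Definition psd_forcing_set S : Prop := exists t, psd_blue S t == [set: T].

(* None stands for infinity in psd_pt and psd_th_set. *)
Definition psd_pt S : option nat :=
  if pselect (psd_forcing_set S) is left fS then Some (ex_minn fS) else None.

Definition psd_th_set S : option nat := omap (addn #|S|) (psd_pt S).

Lemma psd_th_attained :
  exists k, [exists S : {set T}, psd_th_set S == Some k].
Proof.
have fT : psd_forcing_set [set: T] by exists 0.
rewrite /psd_th_set /psd_pt.
exists (#|[set: T]| + ex_minn fT); apply/existsP; exists [set: T].
case: pselect => [h|]; last by [].
by rewrite /= (Prop_irrelevance h fT).
Qed.

Definition psd_th : nat := ex_minn psd_th_attained.

End PSDZeroForcing.

(* ordS x is x + 1 modulo n. *)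
Definition cycle_adj (n : nat) : rel 'I_n :=
  [rel x y | (y == ordS x) || (x == ordS y)].

Lemma cycle_adj_sym n : symmetric (@cycle_adj n).
Proof. by move=> x y; rewrite /cycle_adj /= orbC. Qed.

Lemma cycle_adj_irr n : 1 < n -> irreflexive (@cycle_adj n).
Proof.
move=> n1 x; rewrite /cycle_adj /= orbb; apply/negbTE/eqP => /(congr1 val) /= E.
have := ltn_ord x; rewrite leq_eqVlt => /orP[/eqP Ex|lt].
  by move: E; rewrite Ex modnn => E; move: n1; rewrite -{1}Ex E.
by move: E; rewrite modn_small // => /n_Sn.
Qed.

(* Main.v *)
Require Import Defs.
From mathcomp Require Import all_boot all_order all_algebra.
From mathcomp Require Import boolp reals.
From mathcomp Require Import zify lra.

(** Write [m = k + t] for the cost of a start set of size [k] that turns the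
    whole cycle blue in [t] steps.

    Lower bound.  A force only reaches a neighbour of a blue vertex, so after
    [t] steps each start vertex accounts for at most [2 t + 1] blue vertices,
    and [n <= k (2 t + 1)] ([cycle_size_bound]).  With [m] fixed the right-hand
    side is the concave function [k (2 m + 1 - 2 k)] of [k], whose maximum over
    the integers is [m (m + 1) / 2]; hence [2 n <= m (m + 1)].

    Upper bound.  Two blue vertices cut the cycle into two arcs, and the two
    neighbours of a blue vertex, when white, lie in different components.  So
    as soon as the start set has two elements every white neighbour of a blue
    vertex is forced ([cycle_forces]) and the bound above is met by evenly
    spaced start vertices ([spaced_blue]).  The integer maximum is reached at
    [k] equal to [m / 2] rounded up and [t] equal to [m / 2] rounded down; for
    the least [m] with [2 n <= m (m + 1)] and [n >= 4], this spacing does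
    leave at least two start vertices.

    Thus the throttling number is the least [m] with [2 n <= m (m + 1)].  As
    [m (m + 1) = (m + 1/2)^2 - 1/4] and [2 n] is an integer, the condition says
    [sqrt (2 n) <= m + 1/2], which is the ceiling formula. *)

Set Implicit Arguments.
Unset Strict Implicit.
Unset Printing Implicit Defensive.

Import Order.TTheory GRing.Theory Num.Theory.

(** * Throttling numbers of arbitrary graphs *)

Section Throttling.
Variables (T : finType) (e : rel T).
Implicit Types (B S : {set T}).

Lemma psd_blue_le S s t : s <= t -> psd_blue e S s \subset psd_blue e S t.
Proof.
move=> le_st; rewrite -(subnK le_st); elim: (t - s) => [|i IHi] //=.
by apply: subset_trans IHi _; apply: subsetUl.
Qed.

Lemma psd_step_adj B w :
  w \in psd_step e B -> w \in B \/ exists2 v, v \in B & e v w.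
Proof.
rewrite !inE => /orP[|/existsP[v /and3P[vB _ /eqP forced]]]; first by left.
right; exists v => //.
by have := set11 w; rewrite -forced inE => /andP[].
Qed.

Lemma psd_th_set_eq S k :
  psd_th_set e S = Some k ->
  exists2 t, k = #|S| + t & psd_blue e S t = [set: T].
Proof.
rewrite /psd_th_set /psd_pt; case: pselect => //= fS [<-].
by case: ex_minnP => t /eqP blue_t _; exists t.
Qed.

Lemma psd_th_le S t : psd_blue e S t = [set: T] -> psd_th e <= #|S| + t.
Proof.
move=> blue_t; rewrite /psd_th; case: ex_minnP => m _ m_min.
have fS : psd_forcing_set e S by exists t; apply/eqP.
have pt_le : ex_minn fS <= t by case: ex_minnP => s _; apply; apply/eqP.
apply: leq_trans (_ : #|S| + ex_minn fS <= _); last by rewrite leq_add2l.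
apply: m_min; apply/existsP; exists S.
rewrite /psd_th_set /psd_pt; case: pselect => [fS'|//].
by rewrite (Prop_irrelevance fS' fS).
Qed.

Lemma psd_th_attained_by :
  exists S t, psd_th e = #|S| + t /\ psd_blue e S t = [set: T].
Proof.
rewrite /psd_th; case: ex_minnP => m /existsP[S /eqP/psd_th_set_eq[t mE St]] _.
by exists S, t.
Qed.

End Throttling.

(** * Lower bound: at most two new blue vertices per start vertex and step *)

Section Cycle.
Variable n : nat.
Implicit Types (S B : {set 'I_n}) (u v w x : 'I_n).

(** A ball is parametrised from its far end [s - t], so that a step in either
    direction only changes the index. *)
Definition ball_point t (p : 'I_n * 'I_(t.*2.+1)) : 'I_n :=
  iter p.2 (@ordS n) (iter t (@ord_pred n) p.1).

Lemma psd_blue_sub_balls S t :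
  psd_blue (@cycle_adj n) S t \subset
    [set ball_point p | p in setX S [set: 'I_(t.*2.+1)]].
Proof.
suff ball x : x \in psd_blue (@cycle_adj n) S t ->
    exists s i, [/\ s \in S, i <= t.*2
                  & x = iter i (@ordS n) (iter t (@ord_pred n) s)].
  apply/subsetP => x /ball[s [i [sS it ->]]].
  apply/imsetP; exists (s, @Ordinal t.*2.+1 i it) => //.
  by rewrite !inE sS.
elim: t x => [|t IHt] x /=; first by move=> xS; exists x, 0.
case/psd_step_adj => [/IHt[s [i [sS it xE]]]|[v /IHt[s [i [sS it vE]]]]].
  exists s, i.+1; split=> //; first lia.
  by rewrite iterSr ord_predK.
case/orP => /eqP xE.
  exists s, i.+2; split=> //.
  by rewrite xE vE (iterS i.+1) (iterSr i) /= ord_predK.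
exists s, i; split=> //; first lia.
by rewrite -[LHS](@ordSK n) -xE vE -{1}[iter t _ s]ord_predK -iterSr /= ordSK.
Qed.

Lemma cycle_size_bound S t :
  psd_blue (@cycle_adj n) S t = [set: 'I_n] -> n <= #|S| * t.*2.+1.
Proof.
move=> blue_t; have := subset_leq_card (psd_blue_sub_balls S t).
rewrite blue_t cardsT card_ord => /leq_trans; apply.
by apply: leq_trans (leq_imset_card _ _) _; rewrite cardsX cardsT card_ord.
Qed.

(** * Upper bound: evenly spaced start vertices *)

Lemma cycle_adj_val u v : cycle_adj u v ->
  [\/ v = u.+1 :> nat, u = v.+1 :> nat, u.+1 = n /\ v = 0 :> nat
    | v.+1 = n /\ u = 0 :> nat].
Proof.
have ordS_val x y : y = ordS x -> y = x.+1 :> nat \/ x.+1 = n /\ y = 0 :> nat.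
  move=> -> /=; have := ltn_ord x; rewrite leq_eqVlt => /orP[/eqP xn|xn].
    by right; rewrite xn modnn.
  by left; rewrite modn_small.
by case/orP => /eqP/ordS_val[]; [apply: Or41|apply: Or43|apply: Or42|apply: Or44].
Qed.

(** The vertices [v] and [b] separate the labels between them from the others,
    also across the edge joining [n - 1] to [0]; a white path cannot change
    side, and the two neighbours of [v] are on different sides. *)
Lemma cycle_forces B v b w :
  v \in B -> b \in B -> b != v -> w \notin B -> cycle_adj v w ->
  psd_forces (@cycle_adj n) B v w.
Proof.
move=> vB bB bv wB vw; rewrite /psd_forces vB wB /=.
have white u : u \notin B -> u <> v :> nat /\ u <> b :> nat.
  by move=> uB; split=> /val_inj uE; rewrite uE ?vB ?bB in uB.
have {}bv : b <> v :> nat by move/val_inj => E; rewrite E eqxx in bv.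
pose between u := (minn v b < u) && (u < maxn v b).
have side : closed (white_adj (@cycle_adj n) B) between.
  move=> x y /and3P[/white[? ?] /white[? ?] /cycle_adj_val xy].
  have := (ltn_ord x, ltn_ord y, ltn_ord v, ltn_ord b).
  by rewrite /in_mem /= /between => -[[[]]]; case: xy; lia.
have white_conn u : connect (white_adj (@cycle_adj n) B) w u -> u \notin B.
  have whites : closed (white_adj (@cycle_adj n) B) [predC B].
    by move=> x y /and3P[xB yB _]; rewrite !inE xB yB.
  by move/(closed_connect whites); rewrite !inE wB => <-.
apply/eqP/setP => u; rewrite !inE; apply/idP/eqP => [/andP[wu vu]|->]; last first.
  by rewrite connect0.
have [? ?] := white _ (white_conn _ wu); have [? ?] := white _ wB.
have := closed_connect side wu; rewrite /in_mem /= /between => sides.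
apply: val_inj => /=; move: sides (ltn_ord u) (ltn_ord w) (ltn_ord v) (ltn_ord b).
by case: (cycle_adj_val vu) => [||[]|[]]; case: (cycle_adj_val vw) => [||[]|[]]; lia.
Qed.

Lemma psd_blue_adj S a b t x y :
  a \in S -> b \in S -> b != a -> cycle_adj x y ->
  x \in psd_blue (@cycle_adj n) S t -> y \in psd_blue (@cycle_adj n) S t.+1.
Proof.
move=> aS bS ba xy xB; have SB := subsetP (psd_blue_le (@cycle_adj n) S (leq0n t)).
rewrite /= inE; have [//|yB] /= := boolP (y \in _).
rewrite inE; apply/existsP; exists x.
have [ax|ax] := eqVneq a x; last by apply: (@cycle_forces _ x a) => //; apply: SB.
by apply: (@cycle_forces _ x b) => //; [apply: SB|rewrite -ax].
Qed.

Lemma psd_blue_iter S a b t i s x :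
  a \in S -> b \in S -> b != a -> s \in S -> i <= t ->
  iter i (@ordS n) s = x \/ iter i (@ordS n) x = s ->
  x \in psd_blue (@cycle_adj n) S t.
Proof.
move=> aS bS ba sS it xE.
apply: (subsetP (psd_blue_le (@cycle_adj n) S it)); elim: i x xE {it} => [|i IHi] x.
  by case=> /= [<-|->].
case=> [/= xE|].
  apply: (psd_blue_adj aS bS ba (x := iter i (@ordS n) s)); last by apply: IHi; left.
  by rewrite /cycle_adj /= -xE eqxx.
rewrite iterSr => sE; apply: (psd_blue_adj aS bS ba (x := ordS x)).
  by rewrite /cycle_adj /= eqxx orbT.
by apply: IHi; right.
Qed.

Lemma val_iter_ordS i x : iter i (@ordS n) x = (x + i) %% n :> nat.
Proof.
elim: i => [|i IHi] /=; first by rewrite addn0 modn_small.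
by rewrite IHi -addn1 modnDml addn1 addnS.
Qed.

Definition spaced (d : nat) : {set 'I_n} := [set x : 'I_n | d %| x].

Lemma card_spaced k d : 0 < d -> n <= k * d -> #|spaced d| <= k.
Proof.
move=> d_gt0 n_le.
have quo_lt (x : 'I_n) : x %/ d < k.
  by rewrite ltn_divLR //; apply: leq_trans n_le.
rewrite -[k in _ <= k]card_ord -cardsT.
rewrite -(@card_in_imset _ _ (fun x => Ordinal (quo_lt x)) (mem (spaced d))).
  by apply: subset_leq_card; apply: subsetT.
move=> x y; rewrite !inE => dx dy /(congr1 val) /= quo_eq.
by apply: val_inj; rewrite /= -(divnK dx) -(divnK dy) quo_eq.
Qed.

(** Past the last multiple of the spacing, the next start vertex clockwise is
    [0], at distance [n - x], which is at most the distance to the next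
    multiple. *)
Lemma spaced_blue t : t.*2.+1 < n ->
  psd_blue (@cycle_adj n) (spaced t.*2.+1) t = [set: 'I_n].
Proof.
set d := t.*2.+1 => dn; have n_gt0 : 0 < n by lia.
pose z := Ordinal n_gt0; pose b := Ordinal dn.
have zS : z \in spaced d by rewrite inE dvdn0.
have bS : b \in spaced d by rewrite inE /=.
have bz : b != z by [].
apply/eqP; rewrite -subTset; apply/subsetP => x _.
have x_n := ltn_ord x.
have xE := divn_eq x d; have r_d : x %% d < d by rewrite ltn_mod.
set q := x %/ d in xE; set r := x %% d in xE r_d.
have [rt|tr] := leqP r t.
  have qn : q * d < n by lia.
  apply: (psd_blue_iter zS bS bz (s := Ordinal qn) (i := r)) => //.
    by rewrite inE /= dvdn_mull.
  by left; apply: val_inj; rewrite /= val_iter_ordS /= -xE modn_small.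
have [qn|nq] := ltnP (q.+1 * d) n.
  apply: (psd_blue_iter zS bS bz (s := Ordinal qn) (i := d - r)).
  - by rewrite inE /= dvdn_mull.
  - by rewrite /d; lia.
  right; apply: val_inj; rewrite /= val_iter_ordS.
  have -> : x + (d - r) = q.+1 * d by rewrite mulSn; lia.
  by rewrite modn_small.
apply: (psd_blue_iter zS bS bz (s := z) (i := n - x)) => //.
  by move: nq; rewrite mulSn /d; lia.
by right; apply: val_inj; rewrite /= val_iter_ordS subnKC ?modnn // ltnW.
Qed.

(** * The throttling number as an inverse of triangular numbers *)

(** [8 k (2 t + 1) = (2 m + 1)^2 - (2 k - 2 t - 1)^2] with [m = k + t], and the
    square subtracted is odd, hence at least [1]. *)
Lemma size_product_bound k t : (k * t.*2.+1).*2 <= (k + t) * (k + t).+1.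
Proof. by case: (leqP k t) => ?; nia. Qed.

Lemma psd_th_cycle_lower : n.*2 <= psd_th (@cycle_adj n) * (psd_th (@cycle_adj n)).+1.
Proof.
have [S [t [-> /cycle_size_bound n_le]]] := psd_th_attained_by (@cycle_adj n).
by apply: leq_trans (size_product_bound _ _); rewrite leq_double.
Qed.

(** Only the least such [m0] is realised by a construction: its minimality gives
    [m0 (m0 - 1) < 2 n], which keeps the spacing below [n], so that there are two
    start vertices. *)
Lemma psd_th_cycle_le m : 4 <= n -> n.*2 <= m * m.+1 -> psd_th (@cycle_adj n) <= m.
Proof.
move=> n4 nm; have ex_m : exists m, n.*2 <= m * m.+1 by exists m.
case: (ex_minnP ex_m) => m0 nm0 m0_min; apply: leq_trans (m0_min _ nm).
have m0_gt2 : 2 < m0 by nia.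
have m0_pred : m0.-1 * m0 < n.*2.
  by rewrite ltnNge; apply/negP => h; have := m0_min m0.-1; rewrite prednK; lia.
have m0E := odd_double_half m0; set t := m0./2 in m0E.
have dn : t.*2.+1 < n by nia.
apply: leq_trans (psd_th_le (spaced_blue dn)) _.
have kd : n <= (m0 - t) * t.*2.+1 by case: (odd m0) m0E => m0E; nia.
by apply: leq_trans (leq_add (card_spaced (ltn0Sn _) kd) (leqnn t)) _; lia.
Qed.

End Cycle.

Local Open Scope ring_scope.

Theorem theorem3p3 (R : realType) (n : nat) (hn : (4 <= n)%N) :
  Posz (psd_th (@cycle_adj n)) = Num.ceil (Num.sqrt (2 * n%:R : R) - 1 / 2).
Proof.
have lower := psd_th_cycle_lower n.
have upper := fun m => psd_th_cycle_le (m := m) hn.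
set m := psd_th _ in lower upper *.
have m_gt0 : (0 < m)%N by nia.
have strict : (m.-1 * m < n.*2)%N.
  by rewrite ltnNge; apply/negP => h; have := upper m.-1; rewrite prednK //; lia.
have lowerR : 2 * n%:R <= m%:R * (m%:R + 1) :> R.
  by rewrite natr1 -!natrM ler_nat mul2n.
have strictR : (m%:R - 1) * m%:R + 1 <= 2 * n%:R :> R.
  by rewrite -(natrB R m_gt0) -!natrM natr1 ler_nat mul2n subn1.
have m_ge1 : 1 <= m%:R :> R by rewrite ler1n.
have n_ge0 : 0 <= 2 * n%:R :> R by rewrite mulr_ge0 ?ler0n.
apply/esym/ceil_def.
have sqr_sqrt := sqr_sqrtr n_ge0; have sqrt_ge0 := sqrtr_ge0 (2 * n%:R : R).
rewrite intrD /= -pmulrn; apply/andP; split; nra.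
Qed.
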